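(* Let $q$ be a prime power and let $n\ge 1$. The expected number of eigenvectors of a uniformly random $F$-stable maximal torus of $GL_n(\overline{F_q})$ is equal to $$1+\frac{1}{q}+\frac{1}{q^2}+\cdots+\frac{1}{q^{n-1}}.$$
   Context: $F_q$ is the finite field with $q$ elements and $F$ denotes the Frobenius map on $GL_n(\overline{F_q})$ raising each matrix entry to the $q$-th power. A maximal torus $T$ of $GL_n(\overline{F_q})$ is $F$-stable if $F(T)=T$; the set of such tori is finite, and a random one is chosen uniformly from it. The number of eigenvectors of $T$ means the number of lines in the projective space $P^{n-1}(F_q)$ (i.e. one-dimensional subspaces of $\overline{F_q}^n$ defined over $F_q$) fixed by $T$. *)

(* Defs.v *)
From HB Require Import structures.
From mathcomp Require Export all_boot all_order all_algebra all_field finmap.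
From mathcomp Require Export boolp classical_sets functions cardinality.
From mathcomp Require Export mpoly.

Set Implicit Arguments.
Unset Strict Implicit.
Unset Printing Implicit Defensive.

Export GRing.Theory.

Local Open Scope classical_set_scope.
Local Open Scope ring_scope.

(* Algebraic subgroups of GL_n(K) are handled through their K-points, as sets
   of matrices; this is legitimate for K algebraically closed. *)

Definition is_subgroup (K : fieldType) (n : nat) (G : set 'M[K]_n) : Prop :=
  [/\ forall g, G g -> g \in unitmx,
      G 1%:M,
      forall g h, G g -> G h -> G (g *m h)
    & forall g, G g -> G (invmx g)].

(* Polynomials in the n * n entries, without 1 / det, suffice: multiplying an
   equation by a power of det does not change its zero locus in GL_n. *)
Definition zariski_closed_in_GL (K : fieldType) (n : nat) (G : set 'M[K]_n) :
    Prop :=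
  exists S : set {mpoly K[n * n]},
    forall g : 'M[K]_n,
      G g <-> g \in unitmx /\ forall p, S p -> p.@[mxvec g 0] = 0.

Definition is_closed_subgroup (K : fieldType) (n : nat) (G : set 'M[K]_n) :
    Prop :=
  is_subgroup G /\ zariski_closed_in_GL G.

(* Regular functions on a closed subset of GL_n are the restrictions of the
   elements of K[X_11, ..., X_nn, 1 / det]. *)
Definition regular_on (K : fieldType) (n m : nat) (G : set 'M[K]_n)
    (f : 'M[K]_n -> 'M[K]_m) : Prop :=
  forall (i j : 'I_m), exists (p : {mpoly K[n * n]}) (k : nat),
    forall g, G g -> f g i j = p.@[mxvec g 0] / (\det g) ^+ k.

Definition is_algebraic_group_morphism (K : fieldType) (n m : nat)
    (G : set 'M[K]_n) (H : set 'M[K]_m) (f : 'M[K]_n -> 'M[K]_m) : Prop :=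
  [/\ forall g, G g -> H (f g),
      forall g h, G g -> G h -> f (g *m h) = f g *m f h
    & regular_on G f].

Definition algebraic_groups_isomorphic (K : fieldType) (n m : nat)
    (G : set 'M[K]_n) (H : set 'M[K]_m) : Prop :=
  exists (f : 'M[K]_n -> 'M[K]_m) (f' : 'M[K]_m -> 'M[K]_n),
    [/\ is_algebraic_group_morphism G H f,
        is_algebraic_group_morphism H G f',
        forall g, G g -> f' (f g) = g
      & forall h, H h -> f (f' h) = h].

(* The group D_r(K) of invertible diagonal matrices, i.e. (G_m)^r. *)
Definition diagonal_group (K : fieldType) (r : nat) : set 'M[K]_r :=
  [set d | d \in unitmx /\ is_diag_mx d].
Arguments diagonal_group K r : clear implicits.

Definition is_torus (K : fieldType) (n : nat) (T : set 'M[K]_n) : Prop :=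
  is_closed_subgroup T /\
  exists r : nat, algebraic_groups_isomorphic (diagonal_group K r) T.

Definition is_maximal_torus (K : fieldType) (n : nat) (T : set 'M[K]_n) :
    Prop :=
  is_torus T /\ forall T' : set 'M[K]_n, is_torus T' -> T `<=` T' -> T' = T.

Definition frobenius_mx (K : fieldType) (q n : nat) (g : 'M[K]_n) : 'M[K]_n :=
  map_mx (fun x : K => x ^+ q) g.
Arguments frobenius_mx {K} q {n} g.

Definition stable_maximal_tori (K : fieldType) (q n : nat) :
    set (set 'M[K]_n) :=
  [set T | is_maximal_torus T /\ frobenius_mx q @` T = T].
Arguments stable_maximal_tori K q n : clear implicits.

(* GL_n acts on column vectors.  A line of K^n is defined over F when it is
   spanned by a vector with coordinates in F, i.e. when it is a point of
   P^{n-1}(F). *)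
Definition rational_lines (F K : fieldType) (iota : {rmorphism F -> K})
    (n : nat) : set {vspace 'cV[K]_n} :=
  [set L | \dim L = 1%N /\ exists v : 'cV[F]_n, L = <[map_mx iota v]>%VS].

Definition eigenlines (F K : fieldType) (iota : {rmorphism F -> K}) (n : nat)
    (T : set 'M[K]_n) : set {vspace 'cV[K]_n} :=
  [set L | rational_lines iota L /\
           forall g, T g -> (linfun (mulmx g) @: L)%VS = L].

(* [fset_set A] is empty when A is infinite; the next lemma shows that this
   never happens for the sets counted by [num_eigenvectors]. *)
Lemma finite_eigenlines (F : finFieldType) (K : fieldType)
    (iota : {rmorphism F -> K}) (n : nat) (T : set 'M[K]_n) :
  finite_set (eigenlines iota T).
Proof.
apply: (@sub_finite_set _ _
  ((fun v : 'cV[F]_n => <[map_mx iota v]>%VS) @` [set: 'cV[F]_n])).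
  by move=> L [[_ [v ->]] _]; exists v.
exact/finite_image/finite_finset.
Qed.

Definition num_eigenvectors (F : finFieldType) (K : fieldType)
    (iota : {rmorphism F -> K}) (n : nat) (T : set 'M[K]_n) : nat :=
  #|` fset_set (eigenlines iota T)|%fset.

(* Only meaningful for finite nonempty A. *)
Definition uniform_expectation (X : choiceType) (A : set X) (f : X -> rat) :
    rat :=
  (\sum_(x <- fset_set A) f x) / #|` fset_set A|%fset%:R.

(* Main.v *)
From HB Require Import structures.
From mathcomp Require Import all_fingroup all_solvable.
Require Import Defs.

(** Write phi for the Frobenius x |-> x^q of K and W for the symmetric group
    on the n columns.

    Every element of a torus T has finite order prime to the characteristic,
    since K is algebraic over a finite field; so T is a commuting family of
    diagonalizable matrices, and the maximal tori are exactly the conjugates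
    [torus_of g] of the diagonal group ([maximal_torusP]).  Such a torus
    amounts to the set of n lines spanned by the columns of g.  It is
    Frobenius-stable when phi permutes these lines, and a line in it is counted
    as an eigenvector precisely when phi fixes it.  Scale each column so that
    a coordinate chosen canonically is 1.  Then phi permutes the scaled
    columns themselves: phi(g) = g P_w for some w in W.  Let Nb_w be the set of
    these normalized bases ([normal_bases w]).  A stable torus has n! orderings
    of its lines, so the expectation is
        (sum_w |Nb_w| fix(w)) / (sum_w |Nb_w|),
    with fix(w) the number of fixed points of w ([num_eigenvectors_torus_of],
    [ncard_frames_of_torus]).

    The row vectors r with phi(r) = r P_w form an n-dimensional space R_w over
    F_q which spans K^n ([exists_twisted_basis], a form of Lang's theorem for
    P_w).  Hence |R_w| = q^n, and the number of g in GL_n(K) with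
    phi(g) = g P_w is |GL_n(F_q)| for every w.  For a set S of columns let
    rho(w, S) be the number of r in R_w with support S ([rows_on w S]).  Scaling columns gives
    |Nb_w| rho(w, all) = |GL_n(F_q)|, and if w preserves S then
    rho(w, S) rho(w, S^c) = rho(w, all).  So for such w
        |Nb_w| rho(w, S) = |GL_n(F_q)| / rho(w, S^c),
    which depends only on the restriction of w to S^c, while rho(w, S) = 0 for
    the other w.  The restriction of w to S being thus uniformly distributed,
    its mean number of fixed points is 1 when S is nonempty:
        sum_w |Nb_w| rho(w, S) = sum_w |Nb_w| rho(w, S) #{i in S | w i = i}
    ([fixed_points_average]).  Summing over all nonempty S, the left side
    counts the nonzero elements of R_w, and the right side counts, for each
    fixed point i of w, the r in R_w with r_i <> 0.  This gives
        (q^n - 1) sum_w |Nb_w| = (q - 1) q^(n-1) sum_w |Nb_w| fix(w)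
    ([sum_normal_bases]), so the expectation is
    (q^n - 1) / ((q - 1) q^(n-1)), the sum of the q^-i for i < n. *)

Set Implicit Arguments.
Unset Strict Implicit.
Unset Printing Implicit Defensive.

Import Num.Theory.

Local Open Scope classical_set_scope.
Local Open Scope ring_scope.

(** * Cardinalities of finite sets *)

Definition ncard (X : choiceType) (A : set X) : nat := #|` fset_set A|%fset.

Lemma ncard_image (X Y : choiceType) (A : set X) (f : X -> Y) :
  finite_set A -> {in A &, injective f} -> ncard (f @` A) = ncard A.
Proof.
move=> finA f_inj; rewrite /ncard fset_set_image // card_in_imfset //.
move=> x y; rewrite !in_fset_set //; exact: f_inj.
Qed.

Lemma ncard_bij (X Y : choiceType) (A : set X) (B : set Y)
    (f : X -> Y) (g : Y -> X) :
  finite_set A ->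
  (forall x, A x -> B (f x) /\ g (f x) = x) ->
  (forall y, B y -> A (g y) /\ f (g y) = y) ->
  ncard A = ncard B.
Proof.
move=> finA AB BA; have -> : B = f @` A.
  apply/seteqP; split=> [y By | _ [x Ax <-]]; last by have [] := AB x Ax.
  by have [Agy fgy] := BA y By; exists (g y).
rewrite ncard_image //; apply: (can_in_inj (g := g)) => x.
by rewrite inE => /AB[].
Qed.

Lemma ncard_finType (T : finType) (P : pred T) :
  ncard [set x | P x] = #|[pred x | P x]|.
Proof.
rewrite /ncard cardE; apply/perm_size/uniq_perm; rewrite ?enum_uniq //.
move=> x; rewrite in_fset_set; last exact: finite_finset.
by rewrite mem_enum; apply/idP/idP; rewrite !inE.
Qed.

Lemma ncard_setT (T : finType) : ncard [set: T] = #|T|.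
Proof.
rewrite (_ : [set: T] = [set x | xpredT x]) ?ncard_finType //.
by apply/seteqP; split.
Qed.

Lemma ncard_setX (X Y : choiceType) (A : set X) (B : set Y) :
  finite_set A -> finite_set B -> ncard (A `*` B) = (ncard A * ncard B)%N.
Proof.
move=> finA finB; rewrite /ncard fset_setX //.
rewrite -(size_allpairs pair); apply/perm_size/uniq_perm => //.
  by apply: allpairs_uniq => // -[x y] [x' y'].
move=> -[x y]; rewrite in_fsetM /=; apply/andP/allpairsP => [[xA yB]|].
  by exists (x, y).
by case=> -[x' y'] /= [xA yB [-> ->]].
Qed.

Lemma ncard_sub (X : choiceType) (A : set X) (P : pred X) :
  finite_set A ->
  ncard [set x | A x /\ P x] = (\sum_(x <- fset_set A | P x) 1)%N.
Proof.
move=> finA.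
have finAP : finite_set [set x | A x /\ P x].
  by apply: sub_finite_set finA => x [].
rewrite sum1_count -size_filter /ncard.
apply/perm_size/uniq_perm; rewrite ?filter_uniq ?fset_uniq // => x.
rewrite mem_filter !in_fset_set //; apply/idP/andP; rewrite !inE.
  by case=> Ax Px; split=> //; rewrite inE.
by case=> Px.
Qed.

Lemma ncard_fibers (X : choiceType) (J : finType) (A : set X) (p : X -> J) :
  finite_set A ->
  ncard A = (\sum_j ncard [set x | A x /\ p x == j])%N.
Proof.
move=> finA; rewrite {1}/ncard -sum1_size (partition_big p xpredT) //=.
by apply: eq_bigr => j _; rewrite ncard_sub.
Qed.

(** The transfer from normalized bases to tori: F is constant along the fibers
    of f, which all have N points. *)
Lemma sum_over_fibers (X Y : choiceType) (V : nmodType) (A : set X) (B : set Y)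
    (f : X -> Y) (F : Y -> V) (N : nat) :
  finite_set A -> f @` A = B ->
  (forall y, B y -> ncard [set x | A x /\ f x == y] = N) ->
  \sum_(x <- fset_set A) F (f x) = (\sum_(y <- fset_set B) F y) *+ N.
Proof.
move=> finA fAB cardN.
have finB : finite_set B by rewrite -fAB; exact: finite_image.
have split_x x : x \in fset_set A ->
    F (f x) = \sum_(y <- fset_set B | y == f x) F y.
  rewrite in_fset_set // inE => Ax.
  rewrite (fbig_pred1_inj (k := id)) //.
  by rewrite in_fset_set // inE -fAB; exists x.
rewrite (eq_big_seq _ split_x) (exchange_big_dep xpredT) //= -sumrMnl.
apply: eq_big_seq => y; rewrite in_fset_set // inE => By.
rewrite -(cardN y By) ncard_sub // -sumrMnr.
by apply: eq_bigl => x; rewrite eq_sym.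
Qed.

Lemma ncard_const_fibers (X Y : choiceType) (A : set X) (B : set Y)
    (f : X -> Y) (N : nat) :
  finite_set A -> f @` A = B ->
  (forall y, B y -> ncard [set x | A x /\ f x == y] = N) ->
  ncard A = (ncard B * N)%N.
Proof.
move=> finA fAB cardN; have := sum_over_fibers (fun=> 1%N) finA fAB cardN.
rewrite -[X in _ = X -> _]mulr_natr natn.
by rewrite (sum1_size (fset_set A)) (sum1_size (fset_set B)).
Qed.

(** * The Frobenius map of an algebraically closed field *)

Section Frobenius.
Variables (F : finFieldType) (K : closedFieldType) (iota : {rmorphism F -> K}).
Let q := #|F|.

Lemma pchar_nat_card : [pchar K].-nat q.
Proof.
have [p p_pr pF] := finPcharP F.
have pK : p \in [pchar K] by rewrite (rmorph_pchar iota).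
rewrite (eq_pnat _ (pcharf_eq pK)).
have /and3P[pg _ _] := fin_ring_pchar_abelem pF.
by move: pg; rewrite /pgroup cardsT.
Qed.

Lemma frobenius_rmorphism :
  exists phi : {rmorphism K -> K}, forall x, phi x = x ^+ q.
Proof.
pose f (x : K) := x ^+ q.
have fD : nmod_morphism f.
  split=> [|x y]; first by rewrite /f expr0n gtn_eqF // (ltnW (finNzRing_gt1 F)).
  by rewrite /f exprDn_pchar ?pchar_nat_card.
have fM : monoid_morphism f.
  by split=> [|x y]; rewrite /f ?expr1n ?exprMn.
pose fadd := GRing.isNmodMorphism.Build K K f fD.
pose fmul := GRing.isMonoidMorphism.Build K K f fM.
pose phi : {rmorphism K -> K} := HB.pack f fadd fmul.
by exists phi.
Qed.

Variables (phi : {rmorphism K -> K}) (phiE : forall x, phi x = x ^+ q).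

Lemma frob_iota a : phi (iota a) = iota a.
Proof. by rewrite phiE -rmorphXn expf_card. Qed.

(** X^q - X splits over F, so its roots in K all come from F. *)
Lemma frob_fixedP x : phi x = x <-> exists a, x = iota a.
Proof.
split=> [phix|[a ->]]; last exact: frob_iota.
have : root (map_poly iota ('X^q - 'X)) x.
  by rewrite rmorphB /= map_polyXn map_polyX rootE !hornerE -phiE phix subrr.
rewrite finField_genPoly rmorph_prod /= => /rootP.
rewrite horner_prod => /eqP; rewrite prodf_seq_eq0 => /hasP[a _].
by rewrite /= map_polyXsubC hornerXsubC subr_eq0 => /eqP ->; exists a.
Qed.

Lemma iter_frobE k x : iter k phi x = x ^+ (q ^ k).
Proof. by elim: k => [|k IHk] //=; rewrite IHk phiE -exprM -expnSr. Qed.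

Lemma expq_gt1 k : (0 < k)%N -> (1 < q ^ k)%N.
Proof. by move=> k_gt0; rewrite -(exp1n k) ltn_exp2r // finNzRing_gt1. Qed.

(** The derivative of X^(q^k) - X is -1, so this polynomial has no multiple
    root. *)
Lemma frob_poly_split k : (0 < k)%N ->
  exists2 s : seq K, uniq s &
    'X^(q ^ k) - 'X = \prod_(z <- s) ('X - z%:P).
Proof.
move=> k_gt0.
have Q_gt1 := expq_gt1 k_gt0.
have [s def_s] := closed_field_poly_normal ('X^(q ^ k) - 'X : {poly K}).
have szX : (size (- 'X : {poly K}) < size ('X^(q ^ k) : {poly K}))%N.
  by rewrite size_polyN size_polyX size_polyXn ltnS.
rewrite lead_coefDl // lead_coefXn scale1r in def_s.
exists s => //; rewrite -separable_prod_XsubC -def_s.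
rewrite unlock /separable_poly derivB derivXn derivX.
suff -> : 'X^((q ^ k).-1) *+ (q ^ k) = 0 :> {poly K}.
  by rewrite sub0r -[- 1]scaleN1r coprimepZr ?oppr_eq0 ?oner_eq0 ?coprimep1.
rewrite -mulr_natr -polyC_natr.
have -> : (q ^ k)%:R = 0 :> K; last by rewrite polyC0 mulr0.
have q0 : q%:R = 0 :> K.
  have [p p_pr pF] := finPcharP F.
  have pK : p \in [pchar K] by rewrite (rmorph_pchar iota).
  apply/eqP; rewrite -(dvdn_pcharf pK).
  have := pchar_nat_card; rewrite (eq_pnat _ (pcharf_eq pK)) => /p_natP[[|e] qE].
    by have := finNzRing_gt1 F; rewrite -/q qE.
  by rewrite qE expnS dvdn_mulr.
by case: k k_gt0 {Q_gt1 s def_s szX} => // k _; rewrite expnS natrM q0 mul0r.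
Qed.

Lemma frob_fixed_seq k : (0 < k)%N ->
  exists s : seq K, [/\ uniq s, size s = (q ^ k)%N
    & forall x, (x \in s) = (iter k phi x == x)].
Proof.
move=> k_gt0; have [s s_uniq sE] := frob_poly_split k_gt0; exists s; split=> //.
  apply: succn_inj; rewrite -(size_prod_XsubC s id) -sE size_polyDl size_polyXn //.
  by rewrite size_polyN size_polyX ltnS expq_gt1.
move=> x; rewrite -root_prod_XsubC -sE rootE !hornerE iter_frobE.
by rewrite subr_eq0.
Qed.

(** A polynomial over F with root x has all the phi^k(x) as roots.  They are
    finitely many and phi is injective, so the orbit returns to x. *)
Lemma algebraic_periodic x : algebraicOver iota x ->
  exists2 k, (0 < k)%N & iter k phi x = x.
Proof.
case=> p p_neq0 px.
have [s sE] := closed_field_poly_normal (map_poly iota p).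
have p'_neq0 : map_poly iota p != 0 by rewrite map_poly_eq0.
have orbit_s k : iter k phi x \in s.
  have : root (map_poly iota p) (iter k phi x).
    elim: k => [|k IHk] //=; rewrite rootE.
    have {1}-> : map_poly iota p = map_poly phi (map_poly iota p).
      rewrite -map_poly_comp; apply: eq_map_poly => a /=.
      by rewrite frob_iota.
    by rewrite horner_map (rootP IHk) rmorph0.
  by rewrite sE rootZ ?lead_coef_eq0 // root_prod_XsubC.
apply: contrapT => noperiod.
have iter_inj k : injective (iter k phi).
  by elim: k => [|k IHk] y z //= /fmorph_inj/IHk.
have orbit_inj : injective (fun k => iter k phi x).
  suff lt_neq i j : (i < j)%N -> iter i phi x <> iter j phi x.
    by move=> i j; case: (ltngtP i j) => // [/lt_neq|/lt_neq/nesym].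
  move=> lt_ij; rewrite -(subnKC (ltnW lt_ij)) iterD => /iter_inj per.
  by apply: noperiod; exists (j - i)%N; rewrite ?subn_gt0.
have := @uniq_leq_size _ (mkseq (fun k => iter k phi x) (size s).+1) s.
rewrite size_mkseq ltnn mkseq_uniq // => /(_ isT) absurd; apply: notF.
by apply: absurd => _ /mapP[k _ ->].
Qed.

End Frobenius.

(** * Matrices that Frobenius acts on by permuting columns *)

Section Twisted.
Variables (F : finFieldType) (K : closedFieldType) (iota : {rmorphism F -> K}).
Variables (phi : {rmorphism K -> K}) (phiE : forall x, phi x = x ^+ #|F|).
Variable (n : nat).
Implicit Types (w : 'S_n).

(** The equation phi(A) = A P_w: Frobenius sends the column A_j to the column
    A_(w j). *)
Definition twisted m w : set 'M[K]_(m, n) :=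
  [set A | map_mx phi A = col_perm w A].

Lemma twistedP m w (A : 'M[K]_(m, n)) :
  twisted w A <-> forall i j, phi (A i j) = A i (w j).
Proof.
split=> [/matrixP twA i j | twA]; first by have := twA i j; rewrite !mxE.
by apply/matrixP => i j; rewrite !mxE.
Qed.

Lemma twisted_iter m w (A : 'M[K]_(m, n)) k i j :
  twisted w A -> iter k phi (A i j) = A i ((w ^+ k)%g j).
Proof.
move/twistedP=> twA; elim: k j => [|k IHk] j; first by rewrite expg0 perm1.
by rewrite iterSr twA IHk expgS permM.
Qed.

Lemma perm_expg_fact w : (w ^+ n`!)%g = 1%g.
Proof. by rewrite -card_Sn -cardsT expg_cardG ?inE. Qed.

(** The entries of A lie in a finite field: phi^(n!) fixes each of them, because
    w^(n!) = 1. *)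
Lemma finite_twisted m w : finite_set (@twisted m w).
Proof.
have [s [_ _ sP]] := frob_fixed_seq iota phiE (fact_gt0 n).
pose M : set 'M[seq_sub s]_(m, n) := setT.
apply: (@sub_finite_set _ _ [set map_mx val A | A in M]); last first.
  exact/finite_image/finite_finset.
move=> A twA; have sA i j : A i j \in s.
  by rewrite sP (twisted_iter _ _ _ twA) perm_expg_fact perm1.
exists (\matrix_(i, j) SeqSub (sA i j)) => //.
by apply/matrixP => i j; rewrite !mxE.
Qed.

(** For y fixed by phi^N, with N = n!, placing the powers phi^m(y) at the
    columns w^m(i0), and adding up those that fall in the same column, gives a
    row in R_w, as in a trace.  Pairing this row with c yields a
    polynomial in y of degree at most q^(N-1), which cannot vanish at all the
    q^N possible y unless its coefficients do; the coefficient of y is the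
    entry of c at i0. *)
Lemma twisted_rows_separate w (c : 'cV[K]_n) :
  (forall r : 'rV_n, twisted w r -> r *m c = 0) -> c = 0.
Proof.
move=> annc; apply/matrixP => i0 k0; rewrite !ord1 mxE {k0}.
pose N := n`!; have N_gt0 : (0 < N)%N by exact: fact_gt0.
have q_gt1 := finNzRing_gt1 F.
pose p := \sum_(m < N) c ((w ^+ m)%g i0) 0 *: 'X^(#|F| ^ m).
have [s [s_uniq s_size sP]] := frob_fixed_seq iota phiE N_gt0.
have root_p x : x \in s -> root p x.
  rewrite sP => /eqP per_x.
  pose r : 'rV[K]_n := \row_j \sum_(m < N | (w ^+ m)%g i0 == j) iter m phi x.
  have tw_r : twisted w r.
    apply/twistedP => i j; rewrite !mxE rmorph_sum /=.
    pose G m := if (w ^+ m)%g i0 == w j then iter m phi x else 0.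
    have GN : G N = G 0%N by rewrite /G /N perm_expg_fact expg0 per_x.
    (* The summands are N-periodic in m, so the sum may be shifted by one. *)
    have shift_G : \sum_(m < N) G m.+1 = \sum_(m < N) G m.
      apply: (addrI (G 0%N)); rewrite [RHS]addrC -[in RHS]GN.
      by rewrite -(big_ord_recr N (fun m => G m)) big_ord_recl.
    rewrite [RHS]big_mkcond [LHS]big_mkcond /= -shift_G.
    apply: eq_bigr => m _; rewrite /G /= expgSr permM (inj_eq perm_inj).
    by case: ifP; rewrite ?rmorph0.
  have := annc r tw_r => /matrixP/(_ 0 0); rewrite !mxE => rc0.
  rewrite rootE horner_sum; apply/eqP; apply: etrans rc0.
  transitivity (\sum_j \sum_(m < N | (w ^+ m)%g i0 == j)
      (iter m phi x * c j 0)); last first.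
    by apply: eq_bigr => j _; rewrite mxE mulr_suml.
  rewrite (exchange_big_dep xpredT) //=; apply: eq_bigr => m _.
  rewrite (big_pred1 ((w ^+ m)%g i0)) => [|j]; last by rewrite eq_sym.
  by rewrite !hornerE (iter_frobE phiE) mulrC.
have p0 : p = 0.
  apply: (@roots_geq_poly_eq0 _ p s) => //; first exact/allP.
  rewrite s_size; apply: (leq_trans (size_sum _ _ _)).
  apply/bigmax_leqP => m _; apply: leq_trans (size_scale_leq _ _) _.
  by rewrite size_polyXn ltn_exp2l.
have := congr1 (fun u : {poly K} => u`_1) p0.
rewrite coef0 coef_sum (bigD1 (Ordinal N_gt0)) //= big1 ?addr0.
  by rewrite expn0 coefZ coefX eqxx mulr1 expg0 perm1.
move=> m m_neq0; rewrite coefZ coefXn.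
have /negPf -> : 1%N != (#|F| ^ m)%N by rewrite eq_sym -(expn0 #|F|) eqn_exp2l.
by rewrite mulr0.
Qed.

(** Lang's theorem for the permutation matrix of w: no nonzero vector is
    orthogonal to R_w, so R_w contains a basis of K^n. *)
Lemma exists_twisted_basis w : exists2 g : 'M[K]_n, g \in unitmx & twisted w g.
Proof.
pose rs := fset_set (@twisted 1 w) : seq _.
pose A := \matrix_(k < size rs) rs`_k.
have twA k : twisted w (row k A).
  have : rs`_k \in fset_set (@twisted 1 w) by exact: mem_nth.
  by rewrite rowK in_fset_set ?inE //; exact: finite_twisted.
have fullA : row_full A.
  rewrite -cokermx_eq0; apply/eqP/matrixP => i j; rewrite [RHS]mxE.
  have -> : cokermx A i j = col j (cokermx A) i 0 by rewrite [RHS]mxE.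
  suff -> : col j (cokermx A) = 0 by rewrite mxE.
  apply: (@twisted_rows_separate w) => r tw_r.
  have r_rs : r \in rs.
    by rewrite /rs in_fset_set ?inE //; exact: finite_twisted.
  have -> : r = row (Ordinal (etrans (index_mem _ _) r_rs)) A.
    by rewrite rowK /= nth_index.
  by rewrite -row_mul colE mulmxA mulmx_coker mul0mx row0.
exists (rowsub (fullrankfun fullA) A); first exact: fullrowsub_unit.
apply/twistedP => i j; rewrite !mxE.
by have /twistedP/(_ 0 j) := twA (fullrankfun fullA i); rewrite !mxE.
Qed.

Lemma rational_mul_twisted m w (c : 'M[F]_(m, n)) (g : 'M[K]_n) :
  twisted w g -> twisted w (map_mx iota c *m g).
Proof.
rewrite /twisted /= map_mxM => ->; rewrite !col_permE mulmxA.
congr (_ *m _ *m _); apply/matrixP => i j.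
by rewrite !mxE (frob_iota iota phiE).
Qed.

(** Two solutions of the same twisted equation differ by a matrix that phi
    fixes, because the two factors P_w cancel. *)
Lemma twisted_rational m w (A : 'M[K]_(m, n)) (g : 'M[K]_n) :
  g \in unitmx -> twisted w g -> twisted w A ->
  exists c : 'M[F]_(m, n), A = map_mx iota c *m g.
Proof.
move=> g_unit tw_g tw_A; pose B := A *m invmx g.
have phiB : map_mx phi B = B.
  have : map_mx phi B *m col_perm w g = col_perm w A.
    by rewrite -(tw_g : map_mx phi g = _) -map_mxM /B mulmxKV.
  rewrite !col_permE mulmxA => /(can_inj (mulmxK (unitmx_perm _ _))) Bg.
  by rewrite -[LHS](mulmxK g_unit) Bg.
have rationalB i j : exists a, B i j = iota a.
  by apply: (frob_fixedP iota phiE _).1; rewrite -{2}phiB [RHS]mxE.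
exists (\matrix_(i, j) xget 0 [set a | B i j = iota a]).
rewrite -[LHS](mulmxKV g_unit) -/B; congr (_ *m _); apply/matrixP => i j.
rewrite [RHS]mxE [X in iota X]mxE; case: xgetP => [a _ //|no_a].
by have [a Ba] := rationalB i j; case: (no_a a).
Qed.

Definition twisted_bases w : set 'M[K]_n :=
  [set g | g \in unitmx /\ twisted w g].

Lemma finite_twisted_bases w : finite_set (twisted_bases w).
Proof. by apply: sub_finite_set (@finite_twisted n w) => g []. Qed.

(** The right side is |GL_n(F_q)|, whatever w is: multiplication by the
    rational matrices on the left is simply transitive. *)
Lemma ncard_twisted_bases w :
  ncard (twisted_bases w) = ncard [set c : 'M[F]_n | c \in unitmx].
Proof.
have [g g_unit tw_g] := exists_twisted_basis w.
rewrite -(@ncard_image _ _ _ (fun c => map_mx iota c *m g)); first last.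
- move=> c d _ _ /(can_inj (mulmxK g_unit)) /map_mx_inj; exact.
- exact: finite_finset.
congr ncard; apply/seteqP; split=> [h [h_unit tw_h]|_ [c c_unit <-]].
  have [c def_h] := twisted_rational g_unit tw_g tw_h; exists c => //=.
  by move: h_unit; rewrite def_h unitmx_mul g_unit andbT map_unitmx.
split; last exact: rational_mul_twisted.
by rewrite unitmx_mul g_unit map_unitmx c_unit.
Qed.

Lemma ncard_GL_gt0 : (0 < ncard [set c : 'M[F]_n | c \in unitmx])%N.
Proof.
rewrite /ncard cardfs_gt0; apply/fset0Pn; exists 1%:M.
by rewrite in_fset_set; [rewrite inE /= unitmx1 | exact: finite_finset].
Qed.

Lemma ncard_twisted_rows w : ncard (@twisted 1 w) = (#|F| ^ n)%N.
Proof.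
have [g g_unit tw_g] := exists_twisted_basis w.
rewrite -[n in RHS]mul1n -card_mx -ncard_setT.
rewrite -(@ncard_image _ _ _ (fun c => map_mx iota c *m g)); first last.
- move=> c d _ _ /(can_inj (mulmxK g_unit)) /map_mx_inj; exact.
- exact: finite_finset.
congr ncard; apply/seteqP; split=> [h tw_h|_ [c _ <-]].
  by have [c def_h] := twisted_rational g_unit tw_g tw_h; exists c.
exact: rational_mul_twisted.
Qed.

(** When w fixes i, the i-th coordinate of R_w takes its values in F_q, and the
    rational multiples of the i-th unit vector lie in R_w; translating by them
    shows that all the values are taken equally often. *)
Lemma ncard_twisted_neq0 w (i : 'I_n) : w i = i ->
  ncard [set r : 'rV_n | twisted w r /\ r 0 i != 0]
    = ((#|F| - 1) * #|F| ^ n.-1)%N.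
Proof.
move=> wi; pose R0 := [set r : 'rV[K]_n | twisted w r /\ r 0 i == 0].
have q_gt0 := ltnW (finNzRing_gt1 F).
have tw_e a : twisted w (iota a *: delta_mx 0 i : 'rV[K]_n).
  apply/twistedP => k j; rewrite !mxE rmorphM (frob_iota iota phiE).
  by rewrite rmorph_nat -{2}wi (inj_eq perm_inj).
have twB m (A B : 'M_(m, n)) : twisted w A -> twisted w B -> twisted w (A - B).
  move=> /twistedP tA /twistedP tB; apply/twistedP => k j.
  by rewrite !mxE rmorphB tA tB.
have twD m (A B : 'M_(m, n)) : twisted w A -> twisted w B -> twisted w (A + B).
  move=> /twistedP tA /twistedP tB; apply/twistedP => k j.
  by rewrite !mxE rmorphD tA tB.
have e_i a : (iota a *: delta_mx 0 i : 'rV[K]_n) 0 i = iota a.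
  by rewrite !mxE !eqxx mulr1.
have entries : (fun r : 'rV[K]_n => r 0 i) @` twisted w = range iota.
  apply/seteqP; split=> [_ [r /twistedP tw_r <-]|_ [a _ <-]].
    have := tw_r 0 i; rewrite wi => /(frob_fixedP iota phiE)[a ->].
    by exists a.
  by exists (iota a *: delta_mx 0 i).
have fibers y : range iota y ->
    ncard [set r : 'rV[K]_n | twisted w r /\ r 0 i == y] = ncard R0.
  move=> [a _ <-]; apply: (@ncard_bij _ _ _ _
    (fun r => r - iota a *: delta_mx 0 i) (fun r => r + iota a *: delta_mx 0 i)).
  - by apply: sub_finite_set (@finite_twisted 1 w) => r [].
  - move=> r [tw_r /eqP ri]; rewrite subrK; split=> //; split; first exact: twB.
    by rewrite !mxE ri !eqxx mulr1 subrr.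
  - move=> r [tw_r /eqP ri]; rewrite addrK; split=> //; split; first exact: twD.
    by rewrite !mxE ri !eqxx mulr1 add0r.
have R0E : (ncard R0 * #|F| = #|F| ^ n)%N.
  rewrite -(ncard_twisted_rows w).
  rewrite (ncard_const_fibers (@finite_twisted 1 w) entries fibers) mulnC.
  rewrite ncard_image ?ncard_setT //; first exact: finite_finset.
  by move=> a b _ _ /fmorph_inj.
have n_gt0 : (0 < n)%N := leq_ltn_trans (leq0n i) (ltn_ord i).
have {}R0E : ncard R0 = (#|F| ^ n.-1)%N.
  by apply/eqP; rewrite -(eqn_pmul2r q_gt0) R0E -expnSr prednK.
have := ncard_fibers (fun r : 'rV[K]_n => r 0 i != 0) (@finite_twisted 1 w).
rewrite ncard_twisted_rows big_bool /=.
under eq_set do rewrite eqb_id.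
under [X in (_ + ncard X)%N]eq_set do rewrite eqbF_neg negbK.
rewrite -/R0 R0E mulnBl mul1n => sum_card.
by rewrite -(addnK (#|F| ^ n.-1) (ncard _)) -sum_card -expnS prednK.
Qed.

End Twisted.

(** * Counting bases by type of permutation *)

(** The average number of fixed points in S is 1 for any weight W that is
    carried by the permutations preserving S and that does not change when w is
    modified inside S.  For a base point i0 in S, left multiplication by
    [tperm i0 i] matches the w with w i0 = i and the w with w i = i. *)
Lemma fixed_points_average (I : finType) (W : {perm I} -> nat) (S : {set I}) :
  S != finset.set0 ->
  (forall (w : {perm I}) i, i \in S -> w i \notin S -> W w = 0%N) ->
  (forall (w : {perm I}) i j, i \in S -> j \in S -> W (tperm i j * w)%g = W w) ->
  (\sum_w W w = \sum_(w : {perm I}) W w * #|[set i in S | w i == i]|)%N.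
Proof.
case/set0Pn => i0 i0S W0 W_tperm.
transitivity (\sum_(w : {perm I} | w i0 \in S) W w)%N.
  rewrite [RHS]big_mkcond; apply: eq_bigr => w _.
  by case: ifPn => // /W0 ->.
rewrite (partition_big (fun w : {perm I} => w i0) (mem S)) //=.
have fixE (w : {perm I}) : (W w * #|[set i in S | w i == i]|
    = \sum_(i in S) if w i == i then W w else 0)%N.
  rewrite -sum1dep_card big_mkcondr big_distrr /=; apply: eq_bigr => i _.
  by case: ifP; rewrite ?muln1 ?muln0.
rewrite (eq_bigr _ (fun w _ => fixE w)) exchange_big /=.
apply: eq_bigr => i iS.
rewrite -big_mkcond /= (reindex_inj (mulgI (tperm i0 i))) /=.
apply: eq_big => w; first by rewrite permM tpermL andb_idl // => /eqP ->.
by rewrite W_tperm.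
Qed.

Definition support (K : fieldType) (n : nat) (r : 'rV[K]_n) : {set 'I_n} :=
  [set i | r 0 i != 0]%SET.

(** Any nonzero coordinate would do, as long as its position depends only on
    the line spanned by v; this makes [lead] homogeneous and compatible with
    Frobenius. *)
Definition lead (K : fieldType) (n : nat) (v : 'cV[K]_n) : K :=
  if [pick i | v i 0 != 0] is Some i then v i 0 else 0.

Lemma leadZ (K : fieldType) n a (v : 'cV[K]_n) : lead (a *: v) = a * lead v.
Proof.
rewrite /lead; have [->|a_neq0] := eqVneq a 0.
  by case: pickP => [i|]; rewrite ?mxE !mul0r ?eqxx.
rewrite (eq_pick (Q := fun i => v i 0 != 0)) => [|i]; last first.
  by rewrite mxE mulf_eq0 (negPf a_neq0).
by case: pickP => [i _|]; rewrite ?mxE ?mulr0.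
Qed.

Lemma lead_map (K L : fieldType) (f : {rmorphism K -> L}) n (v : 'cV[K]_n) :
  lead (map_mx f v) = f (lead v).
Proof.
rewrite /lead (eq_pick (Q := fun i => v i 0 != 0)) => [|i]; last first.
  by rewrite mxE fmorph_eq0.
by case: pickP => [i _|]; rewrite ?mxE ?rmorph0.
Qed.

Lemma lead_eq0 (K : fieldType) n (v : 'cV[K]_n) : (lead v == 0) = (v == 0).
Proof.
apply/eqP/eqP => [|->]; rewrite /lead; case: pickP => [i|v0].
- by move=> /eqP.
- by move=> _; apply/matrixP => i j; rewrite ord1 mxE; apply/eqP/negbFE/v0.
- by rewrite mxE eqxx.
- by [].
Qed.

Lemma diag_mx_unitP (K : fieldType) n (t : 'rV[K]_n) :
  reflect (forall j, t 0 j != 0) (diag_mx t \in unitmx).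
Proof.
rewrite unitmxE det_diag unitfE.
by apply: (iffP (prodf_neq0 _ _)) => t_neq0 j; [exact: t_neq0 | move=> _].
Qed.

Lemma col_mul_diag (K : fieldType) m n (g : 'M[K]_(m, n)) (t : 'rV[K]_n) j :
  col j (g *m diag_mx t) = t 0 j *: col j g.
Proof. by apply/matrixP => i k; rewrite mul_mx_diag !mxE mulrC. Qed.

Lemma lead_col_neq0 (K : fieldType) n (g : 'M[K]_n) j :
  g \in unitmx -> lead (col j g) != 0.
Proof.
move=> g_unit; rewrite lead_eq0; apply: contraTneq g_unit => gj0.
rewrite unitmxE (expand_det_col _ j) big1 ?unitr0 // => i _.
by have /matrixP/(_ i 0) := gj0; rewrite !mxE => ->; rewrite mul0r.
Qed.

Section Supports.
Variables (F : finFieldType) (K : closedFieldType) (iota : {rmorphism F -> K}).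
Variables (phi : {rmorphism K -> K}) (phiE : forall x, phi x = x ^+ #|F|).
Variable (n : nat).
Implicit Types (w : 'S_n) (S : {set 'I_n}).

Local Notation twisted := (twisted phi).
Let fin_tw w : finite_set (twisted w : set 'rV_n) := finite_twisted iota phiE _ w.

Lemma support_twisted w (r : 'rV[K]_n) i : twisted w r ->
  (w i \in support r) = (i \in support r).
Proof. by move=> /twistedP tw_r; rewrite !inE -tw_r fmorph_eq0. Qed.

Definition rows_on w S : set 'rV[K]_n :=
  [set r | twisted w r /\ support r == S].

Lemma finite_rows_on w S : finite_set (rows_on w S).
Proof. by apply: sub_finite_set (fin_tw w) => r []. Qed.

Lemma ncard_rows_on_sum w (P : pred {set 'I_n}) :
  ncard [set r : 'rV_n | twisted w r /\ P (support r)]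
    = (\sum_(S | P S) ncard (rows_on w S))%N.
Proof.
rewrite (@ncard_fibers _ _ _ (@support K n)); last first.
  by apply: sub_finite_set (fin_tw w) => r [].
rewrite [RHS]big_mkcond; apply: eq_bigr => S _; case: ifPn => PS; last first.
  rewrite (_ : [set _ | _] = set0) /ncard ?fset_set0 ?cardfs0 //.
  by apply/seteqP; split=> // r [[_ Pr] /eqP Sr]; rewrite Sr (negPf PS) in Pr.
congr ncard; apply/seteqP; split=> [r [[]] //|r [tw_r /eqP Sr]] /=.
by rewrite Sr.
Qed.

Lemma ncard_rows_on0 w : ncard (rows_on w finset.set0) = 1%N.
Proof.
rewrite (_ : rows_on w _ = [set 0]) /ncard ?fset_set1 ?cardfs1 //.
apply/seteqP; split=> [r [_ /eqP/setP r0]|_ ->].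
  apply/matrixP => i j; rewrite ord1 mxE; apply/eqP/negbFE.
  by have := r0 j; rewrite !inE.
split; first by apply/twistedP => i j; rewrite !mxE rmorph0.
by apply/eqP/setP => i; rewrite !inE mxE eqxx.
Qed.

Lemma ncard_rows_on_unstable w S i :
  i \in S -> w i \notin S -> ncard (rows_on w S) = 0%N.
Proof.
move=> iS wiS; rewrite (_ : rows_on w S = set0) /ncard ?fset_set0 ?cardfs0 //.
apply/seteqP; split=> // r [tw_r /eqP Sr]; case/negP: wiS.
by rewrite -Sr (support_twisted _ tw_r) Sr.
Qed.

(** A row without zero entries is cut into its parts on S and outside S, and
    both parts still satisfy the twisted equation, as w preserves S. *)
Lemma ncard_rows_on_split w S : (forall i, (w i \in S) = (i \in S)) ->
  (ncard (rows_on w S) * ncard (rows_on w (~: S)%SET)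
    = ncard (rows_on w [set: 'I_n]%SET))%N.
Proof.
move=> wS; rewrite -ncard_setX; try exact: finite_rows_on.
pose cut (A : {set 'I_n}) (r : 'rV[K]_n) : 'rV[K]_n :=
  \row_i (if i \in A then r 0 i else 0).
have tw_cut (A : {set 'I_n}) r : (forall i, (w i \in A) = (i \in A)) ->
    twisted w r -> twisted w (cut A r).
  move=> wA /twistedP tw_r; apply/twistedP => k i; rewrite !mxE wA.
  by case: ifP; rewrite ?rmorph0 ?tw_r.
have supp_cut (A : {set 'I_n}) r : support r == [set: 'I_n]%SET ->
    support (cut A r) == A.
  move/eqP/setP => rT; apply/eqP/setP => i; rewrite inE mxE.
  by case: ifP; rewrite ?eqxx //; have := rT i; rewrite !inE.
have wSC i : (w i \in (~: S)%SET) = (i \in (~: S)%SET).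
  by rewrite !finset.in_setC wS.
apply: (@ncard_bij _ _ _ _ (fun rs => rs.1 + rs.2)
                           (fun r => (cut S r, cut (~: S)%SET r))).
- by apply: finite_setX; exact: finite_rows_on.
- case=> r s [[tw_r /eqP/setP Sr] [tw_s /eqP/setP Ss]] /=.
  have r0 i : i \notin S -> r 0 i = 0.
    by rewrite -Sr inE negbK => /eqP.
  have s0 i : i \in S -> s 0 i = 0.
    by move=> iS; have := Ss i; rewrite !inE iS => /negbFE/eqP.
  split; last first.
    congr (_, _); apply/matrixP => i j; rewrite !ord1 !mxE ?finset.in_setC;
      case: (boolP (j \in S)) => jS /=.
    + by rewrite s0 ?addr0.
    + by rewrite r0.
    + by rewrite s0.
    + by rewrite r0 ?add0r.
  split.
    move/twistedP: tw_r => tr; move/twistedP: tw_s => ts.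
    by apply/twistedP => i j; rewrite !mxE rmorphD tr ts.
  apply/eqP/setP => i; rewrite !inE mxE.
  case: (boolP (i \in S)) => iS.
    by rewrite s0 // addr0; have := Sr i; rewrite !inE iS.
  by rewrite r0 // add0r; have := Ss i; rewrite !inE iS.
- move=> r [tw_r Sr] /=; split.
    by split; split; [exact: tw_cut | exact: supp_cut | exact: tw_cut
                     | exact: supp_cut].
  apply/matrixP => i j; rewrite !ord1 !mxE finset.in_setC.
  by case: (j \in S); rewrite ?addr0 ?add0r.
Qed.

Lemma rows_on_agree w w' S : (forall i, i \in S -> w i = w' i) ->
  (forall i, (w i \in S) = (i \in S)) -> (forall i, (w' i \in S) = (i \in S)) ->
  rows_on w S `<=` rows_on w' S.
Proof.
move=> ww' wS w'S r [/twistedP tw_r Sr]; split=> //; apply/twistedP => k i.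
have [iS|iS] := boolP (i \in S); first by rewrite tw_r ww'.
have r0 j : j \notin S -> r k j = 0.
  by rewrite ord1 -(eqP Sr) inE negbK => /eqP.
by rewrite r0 // rmorph0 r0 // w'S.
Qed.

Definition normal_bases w : set 'M[K]_n :=
  [set g | twisted_bases phi w g /\ forall j, lead (col j g) = 1].

Lemma finite_normal_bases w : finite_set (normal_bases w).
Proof.
by apply: sub_finite_set (finite_twisted_bases (n := n) iota phiE w) => g [].
Qed.

(** A basis g with phi(g) = g P_w is a normalized one times the diagonal matrix
    of the leading coordinates of its columns, and these form a row of R_w
    without zero entries. *)
Lemma ncard_normal_bases w :
  (ncard (normal_bases w) * ncard (rows_on w [set: 'I_n]%SET)
    = ncard [set c : 'M[F]_n | c \in unitmx])%N.
Proof.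
rewrite -(ncard_twisted_bases iota phiE w) -ncard_setX;
  [|exact: finite_normal_bases|exact: finite_rows_on].
pose leads (g : 'M[K]_n) : 'rV[K]_n := \row_j lead (col j g).
have diag_unit (t : 'rV[K]_n) : support t == [set: 'I_n]%SET ->
    diag_mx t \in unitmx.
  by move=> /eqP/setP tT; apply/diag_mx_unitP => j; have := tT j; rewrite !inE.
have tw_diag (g : 'M[K]_n) (t : 'rV[K]_n) : twisted w g -> twisted w t ->
    twisted w (g *m diag_mx t).
  move=> /twistedP tg /twistedP tt; apply/twistedP => i j.
  by rewrite !mul_mx_diag !mxE rmorphM tg tt.
have diagV (g : 'M[K]_n) (t : 'rV[K]_n) : support t == [set: 'I_n]%SET ->
    g *m diag_mx t *m diag_mx (map_mx GRing.inv t) = g.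
  move=> /eqP/setP tT; apply/matrixP => i j; rewrite !mul_mx_diag !mxE mulfK //.
  by have := tT j; rewrite !inE.
apply: (@ncard_bij _ _ _ _ (fun gt => gt.1 *m diag_mx gt.2)
          (fun g => (g *m diag_mx (map_mx GRing.inv (leads g)), leads g))).
- by apply: finite_setX; [exact: finite_normal_bases|exact: finite_rows_on].
- case=> g t [[[g_unit tw_g] g_lead] [tw_t tT]] /=.
  have -> : leads (g *m diag_mx t) = t.
    by apply/matrixP => i j; rewrite ord1 !mxE col_mul_diag leadZ g_lead mulr1.
  split; last by rewrite diagV.
  by split; [rewrite unitmx_mul g_unit diag_unit | exact: tw_diag].
- move=> g [g_unit tw_g] /=.
  have leads_neq0 j : leads g 0 j != 0 by rewrite mxE lead_col_neq0.
  have tw_leads : twisted w (leads g).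
    apply/twistedP => i j; rewrite !mxE -lead_map; congr lead.
    by apply/matrixP => k l; rewrite !mxE; move/twistedP: tw_g => ->.
  have tw_inv : twisted w (map_mx GRing.inv (leads g)).
    move/twistedP: tw_leads => tl; apply/twistedP => i j.
    by rewrite mxE [RHS]mxE fmorphV tl.
  have leadsT : support (leads g) == [set: 'I_n]%SET.
    by apply/eqP/setP => j; rewrite !inE leads_neq0.
  have invT : support (map_mx GRing.inv (leads g)) == [set: 'I_n]%SET.
    by apply/eqP/setP => j; rewrite !inE mxE invr_eq0 leads_neq0.
  split; last first.
    rewrite -[RHS](diagV _ _ invT); congr (_ *m diag_mx _).
    by apply/matrixP => i j; rewrite [RHS]mxE [X in X^-1]mxE invrK.
  split; last by split.
  split; first by split; [rewrite unitmx_mul g_unit diag_unit | exact: tw_diag].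
  move=> j; rewrite col_mul_diag leadZ mxE.
  by have := leads_neq0 j; rewrite mxE => lj; rewrite mulVf.
Qed.

Lemma ncard_full_rows_gt0 w : (0 < ncard (rows_on w [set: 'I_n]%SET))%N.
Proof.
have := ncard_GL_gt0 F n.
by rewrite -(ncard_normal_bases w) muln_gt0 => /andP[].
Qed.

(** If w preserves S, the left and right sides both become |GL_n(F_q)| after
    multiplication by rho(w, S^c), which sees only w outside S; otherwise both
    vanish. *)
Lemma normal_bases_rows_on_tperm w S i j : i \in S -> j \in S ->
  (ncard (normal_bases (tperm i j * w)%g) * ncard (rows_on (tperm i j * w)%g S)
    = ncard (normal_bases w) * ncard (rows_on w S))%N.
Proof.
move=> iS jS; set w' := (tperm i j * w)%g.
have tpermS k : (tperm i j k \in S) = (k \in S).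
  by case: tpermP => // ->; rewrite iS jS.
have [/forallP wS|] := boolP [forall k, (k \in S) ==> (w k \in S)]; last first.
  rewrite negb_forall => /existsP[k]; rewrite negb_imply => /andP[kS wkS].
  rewrite (ncard_rows_on_unstable kS wkS).
  rewrite (@ncard_rows_on_unstable w' S (tperm i j k)) ?tpermS ?muln0 //.
  by rewrite permM tpermK.
have {}wS k : (w k \in S) = (k \in S).
  have wSE : w @: S = S.
    apply/eqP; rewrite eqEcard (card_imset _ perm_inj) leqnn andbT.
    by apply/fintype.subsetP => _ /imsetP[l lS ->]; exact: (implyP (wS l)).
  by rewrite -{1}wSE (mem_imset _ _ perm_inj).
have w'S k : (w' k \in S) = (k \in S) by rewrite permM wS tpermS.
have wSC k : (w k \in (~: S)%SET) = (k \in (~: S)%SET).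
  by rewrite !finset.in_setC wS.
have w'SC k : (w' k \in (~: S)%SET) = (k \in (~: S)%SET).
  by rewrite !finset.in_setC w'S.
have agree k : k \in (~: S)%SET -> w k = w' k.
  rewrite finset.in_setC => kS; rewrite permM tpermD //.
    by apply: contraNneq kS => <-.
  by apply: contraNneq kS => <-.
have rows_eq : rows_on w (~: S)%SET = rows_on w' (~: S)%SET.
  by apply/seteqP; split; apply: rows_on_agree => // k kS; rewrite agree.
have full_gt0 := ncard_full_rows_gt0 w.
have SC_gt0 : (0 < ncard (rows_on w (~: S)%SET))%N.
  by move: full_gt0; rewrite -(ncard_rows_on_split wS) muln_gt0 => /andP[].
apply/eqP; rewrite -(eqn_pmul2r SC_gt0) {1}rows_eq -!mulnA.
by rewrite !ncard_rows_on_split // !ncard_normal_bases.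
Qed.

(** The identities of [fixed_points_average] for the weights |Nb_w| rho(w, S),
    added up over the nonempty sets S. *)
Lemma sum_normal_bases :
  ((#|F| ^ n - 1) * \sum_w ncard (normal_bases w)
    = (#|F| - 1) * #|F| ^ n.-1
      * \sum_w ncard (normal_bases w) * #|[set i | w i == i]%SET|)%N.
Proof.
pose W S w := (ncard (normal_bases w) * ncard (rows_on w S))%N.
have W_average S : (S != finset.set0 -> \sum_w W S w =
    \sum_(w : 'S_n) W S w * #|[set i in S | w i == i]%SET|)%N.
  move=> S_neq0; apply: fixed_points_average => // [w i iS wiS|w i j iS jS].
    by rewrite /W (ncard_rows_on_unstable iS wiS) muln0.
  exact: normal_bases_rows_on_tperm.
have nonzero_rows w :
    (\sum_(S | S != finset.set0) ncard (rows_on w S) = #|F| ^ n - 1)%N.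
  have := ncard_fibers (@support K n) (fin_tw w).
  rewrite -/(rows_on w _) (ncard_twisted_rows iota phiE) => ->.
  rewrite -[RHS]/(\sum_S ncard (rows_on w S) - 1)%N.
  by rewrite [in RHS](bigD1 finset.set0) //= ncard_rows_on0 addKn.
transitivity (\sum_(S | S != finset.set0) \sum_w W S w)%N.
  rewrite exchange_big big_distrr /=; apply: eq_bigr => w _.
  by rewrite -big_distrr /= nonzero_rows mulnC.
rewrite (eq_bigr _ W_average) exchange_big big_distrr /=.
apply: eq_bigr => w _.
transitivity (ncard (normal_bases w) * \sum_(i | w i == i)
    ncard [set r : 'rV[K]_n | twisted w r /\ r 0%R i != 0%R])%N; last first.
  rewrite (eq_bigr (fun=> ((#|F| - 1) * #|F| ^ n.-1)%N)) => [|i /eqP wi].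
    by rewrite sum_nat_cond_const cardsE mulnA mulnC.
  exact: ncard_twisted_neq0.
have row_sum i : (ncard [set r : 'rV[K]_n | twisted w r /\ r 0%R i != 0%R]
    = \sum_(S : {set 'I_n} | i \in S) ncard (rows_on w S))%N.
  rewrite -(ncard_rows_on_sum w (fun S => i \in S)).
  by congr ncard; apply/seteqP; split=> r /=; rewrite inE.
under eq_bigr => S _ do rewrite /W -mulnA.
rewrite -big_distrr /=; congr (_ * _)%N; under [RHS]eq_bigr do rewrite row_sum.
rewrite (exchange_big_dep (fun S : {set 'I_n} => S != finset.set0)) /=.
  apply: eq_bigr => S _; rewrite sum_nat_cond_const mulnC; congr (_ * _)%N.
  by rewrite cardsE; apply: eq_card => i; rewrite !inE andbC.
by move=> i S _ iS; apply/set0Pn; exists i.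
Qed.

End Supports.

(** * Diagonalizable tori *)

(** Reduces the simultaneous diagonalization of an infinite set of matrices to
    that of a finite one. *)
Lemma spanning_subset (K : fieldType) (vT : vectType K) (T : set vT) :
  exists2 X : seq vT, (forall x, x \in X -> T x) &
    forall x, T x -> x \in <<X>>%VS.
Proof.
pose P k := `[< exists2 X : seq vT, (forall x, x \in X -> T x) &
                 \dim <<X>> = k >].
have exP : exists k, P k.
  by exists 0%N; apply/asboolP; exists [::]; rewrite ?span_nil ?dimv0.
have leP k : P k -> (k <= \dim {:vT})%N.
  by case/asboolP => X _ <-; exact/dimvS/subvf.
have [k /asboolP[X XT dimX] max_k] := ex_maxnP exP leP.
exists X => // x Tx.
have le_dim : (\dim <<x :: X>> <= \dim <<X>>)%N.
  rewrite dimX; apply: max_k; apply/asboolP; exists (x :: X) => // y.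
  by rewrite inE => /predU1P[->|/XT].
have subX : (<<X>> <= <<x :: X>>)%VS.
  by apply: sub_span => y; rewrite inE orbC => ->.
have /eqP -> : <<X>>%VS == <<x :: X>>%VS by rewrite eqEdim subX.
by rewrite memv_span // mem_head.
Qed.

Section DiagonalTori.
Variables (K : fieldType) (n : nat).
Implicit Types (a b g h x d : 'M[K]_n).

Definition torus_of g : set 'M[K]_n :=
  [set g *m d *m invmx g | d in diagonal_group K n].

Lemma torus_ofP g x : g \in unitmx ->
  torus_of g x <-> x \in unitmx /\ is_diag_mx (invmx g *m x *m g).
Proof.
move=> g_unit; split=> [[d [d_unit d_diag] <-]|[x_unit x_diag]].
  rewrite !unitmx_mul g_unit d_unit unitmx_inv g_unit; split=> //.
  by rewrite !mulmxA mulVmx // mul1mx mulmxKV.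
exists (invmx g *m x *m g); last by rewrite !mulmxA mulmxV // mul1mx mulmxK.
by split=> //; rewrite !unitmx_mul unitmx_inv g_unit x_unit.
Qed.

(** The (i, j) entry of a x b as a polynomial in the entries of x; it provides
    both the equations of a conjugate of the diagonal group and the regularity
    of conjugation. *)
Definition sandwich_poly a b (i j : 'I_n) : {mpoly K[n * n]} :=
  \sum_k \sum_l (a i k * b l j) *: 'X_(mxvec_index k l).

Lemma sandwich_polyE a b i j x :
  (sandwich_poly a b i j).@[mxvec x 0] = (a *m x *m b) i j.
Proof.
rewrite mxE (eq_bigr (fun l => \sum_k a i k * b l j * x k l)) => [|l _].
  rewrite exchange_big /sandwich_poly raddf_sum; apply: eq_bigr => k _.
  rewrite raddf_sum; apply: eq_bigr => l _ /=.
  by rewrite mevalZ mevalXU mxvecE.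
by rewrite mxE mulr_suml; apply: eq_bigr => k _; rewrite mulrAC.
Qed.

Lemma regular_sandwich (G : set 'M[K]_n) a b :
  regular_on G (fun x => a *m x *m b).
Proof.
move=> i j; exists (sandwich_poly a b i j), 0%N => x _.
by rewrite sandwich_polyE expr0 divr1.
Qed.

Lemma diagonal_group1 : diagonal_group K n 1%:M.
Proof. by split; rewrite ?unitmx1 // /is_true scalar_mx_is_diag. Qed.

Lemma diagonal_groupM d d' : diagonal_group K n d -> diagonal_group K n d' ->
  diagonal_group K n (d *m d').
Proof.
move=> [d_unit /diag_mxP[u def_d]] [d'_unit /diag_mxP[v def_d']].
split; first by rewrite unitmx_mul d_unit.
by rewrite def_d def_d' mulmx_diag diag_mx_is_diag.
Qed.

Lemma diagonal_groupV d : diagonal_group K n d -> diagonal_group K n (invmx d).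
Proof.
move=> [d_unit /diag_mxP[u def_d]]; split; first by rewrite unitmx_inv.
have u_neq0 : forall i, u 0 i != 0 by apply/diag_mx_unitP; rewrite -def_d.
rewrite (_ : invmx d = diag_mx (map_mx GRing.inv u)) ?diag_mx_is_diag //.
apply: (can_inj (mulmxK d_unit)); rewrite mulVmx // def_d mulmx_diag.
rewrite -diag_const_mx; congr diag_mx; apply/matrixP => i j.
by rewrite ord1 !mxE mulVf.
Qed.

Lemma torus_of_is_torus g : g \in unitmx -> is_torus (torus_of g).
Proof.
move=> g_unit; have conjK d : invmx g *m (g *m d *m invmx g) *m g = d.
  by rewrite !mulmxA mulVmx // mul1mx mulmxKV.
split; last first.
  exists n, (fun d => g *m d *m invmx g), (fun x => invmx g *m x *m g).
  split=> //.
  - split=> [d Dd|d d' _ _|]; last exact: regular_sandwich.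
      by exists d.
    by rewrite !mulmxA mulmxKV.
  - split=> [_ [d Dd <-]|_ _ [d _ <-] [d' _ <-]|]; rewrite ?conjK //.
      by rewrite !mulmxA !mulmxKV // -!mulmxA mulKmx // !mulmxA mulmxKV.
    exact: regular_sandwich.
  - by move=> _ [d _ <-]; rewrite conjK.
split; last first.
  exists [set p | exists i j : 'I_n,
            i != j :> nat /\ p = sandwich_poly (invmx g) g i j].
  move=> x; rewrite torus_ofP //; split=> -[x_unit diag_x]; split=> //.
    move=> _ [i [j [ij ->]]]; rewrite sandwich_polyE.
    by move/is_diag_mxP: diag_x => ->.
  apply/is_diag_mxP => i j ij; rewrite -sandwich_polyE; apply: diag_x.
  by exists i, j.
split.
- by move=> x /torus_ofP[].
- by exists 1%:M; [exact: diagonal_group1 | rewrite mulmx1 mulmxV].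
- move=> _ _ [d Dd <-] [d' Dd' <-]; exists (d *m d').
    exact: diagonal_groupM.
  by rewrite !mulmxA mulmxKV.
- move=> _ [d Dd <-]; exists (invmx d); first exact: diagonal_groupV.
  have [d_unit _] := Dd.
  have gdg_unit : g *m d *m invmx g \in unitmx.
    by rewrite !unitmx_mul g_unit d_unit unitmx_inv.
  apply: (can_inj (mulmxK gdg_unit)); rewrite mulVmx // !mulmxA.
  by rewrite !mulmxKV // mulmxV.
Qed.

Lemma torus_commutative (T : set 'M[K]_n) x y :
  is_torus T -> T x -> T y -> x *m y = y *m x.
Proof.
move=> [_ [r [f [f' [[_ fM _] [f'T _ _] _ ff']]]]] Tx Ty.
have {}f'T z : T z -> diagonal_group K r (f' z) by exact: f'T.
rewrite -(ff' x Tx) -(ff' y Ty) -!fM; try exact: f'T.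
move: (f'T x Tx) (f'T y Ty) => [_ /diag_mxP[u ->]] [_ /diag_mxP[v ->]].
by rewrite diag_mxC.
Qed.

Lemma simultaneous_diagonalization (T : set 'M[K]_n) :
  (forall x, T x -> x \in unitmx) ->
  (forall x y, T x -> T y -> x *m y = y *m x) ->
  (forall x, T x -> diagonalizable x) ->
  exists2 g, g \in unitmx & T `<=` torus_of g.
Proof.
move=> Tunit Tcomm Tdiag; have [X XT Xspan] := spanning_subset T.
have /codiagonalizableP[P P_unit /allP Pdiag] :
    {in X &, forall A B, comm_mx A B} /\ {in X, forall A, diagonalizable A}.
  by split=> [x y /XT Tx /XT Ty|x /XT/Tdiag //]; exact: Tcomm.
exists (invmx P); rewrite ?unitmx_inv // => x Tx.
apply/torus_ofP; rewrite ?unitmx_inv // invmxK; split; first exact: Tunit.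
apply/is_diag_mxP => i j ij.
rewrite (coord_span (X := in_tuple X) (Xspan x Tx)).
rewrite mulmx_sumr mulmx_suml summxE big1 // => k _.
rewrite -scalemxAr -scalemxAl mxE.
have := Pdiag _ (mem_nth 0 (ltn_ord k)).
move=> /(diagonalizable_forP _ P_unit)/(_ i j ij) ->.
by rewrite mulr0.
Qed.

Lemma torus_of_eigenbasis g x : g \in unitmx ->
  torus_of g x <-> x \in unitmx /\ exists u, x *m g = g *m diag_mx u.
Proof.
move=> g_unit; rewrite torus_ofP //; split=> -[x_unit].
  move=> /diag_mxP[u def_u]; split=> //; exists u.
  by rewrite -def_u !mulmxA mulmxV // mul1mx.
case=> u xg; split=> //; rewrite -mulmxA xg mulmxA mulVmx // mul1mx.
exact: diag_mx_is_diag.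
Qed.

(** A diagonal matrix with distinct nonzero entries e is a regular element: the
    matrices that commute with it are diagonal, and its conjugates determine
    their eigenlines up to order. *)
Section Regular.
Variable (e : 'rV[K]_n).
Hypotheses (e_inj : injective (e 0)) (e_neq0 : forall i, e 0 i != 0).

Lemma diagonal_group_regular : diagonal_group K n (diag_mx e).
Proof.
split; last exact: diag_mx_is_diag.
exact/diag_mx_unitP.
Qed.

(** A larger torus is commutative, so it centralizes the conjugate by g of the
    regular element. *)
Lemma torus_of_maximal g : g \in unitmx -> is_maximal_torus (torus_of g).
Proof.
move=> g_unit; split; first exact: torus_of_is_torus.
move=> T T_torus gT; apply/seteqP; split=> // x Tx.
have x_unit : x \in unitmx by case: T_torus => -[[+ _ _ _] _ _]; exact.
apply/torus_ofP => //; split=> //.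
have /(torus_commutative T_torus Tx) : T (g *m diag_mx e *m invmx g).
  by apply: gT; exists (diag_mx e) => //; exact: diagonal_group_regular.
set y := invmx g *m x *m g => xC.
have yC : y *m diag_mx e = diag_mx e *m y.
  have := congr1 (fun z => invmx g *m z *m g) xC.
  by rewrite /y !mulmxA !mulmxKV // mulVmx // mul1mx.
clearbody y; apply/is_diag_mxP => i j /negPf ij; apply/eqP.
apply: contraFT ij => yij_neq0.
have := congr1 (fun z : 'M_n => z i j) yC.
rewrite mul_mx_diag mul_diag_mx !mxE mulrC => /(mulIf yij_neq0)/e_inj ->.
exact: eqxx.
Qed.

(** Maximality leaves a single inclusion to check: an x that scales the columns
    of h scales those of g. *)
Lemma torus_of_monomial g h (w : 'S_n) (t : 'rV[K]_n) :
  g \in unitmx -> h \in unitmx -> h = col_perm w g *m diag_mx t ->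
  torus_of h = torus_of g.
Proof.
move=> g_unit h_unit def_h; have [_ h_max] := torus_of_maximal h_unit.
apply/esym/h_max => [|x /torus_of_eigenbasis]; first exact: torus_of_is_torus.
move=> /(_ h_unit)[x_unit [u xh]]; apply/torus_of_eigenbasis => //.
split=> //; exists (\row_i u 0 ((w^-1)%g i)).
have t_neq0 : forall j, t 0 j != 0.
  by apply/diag_mx_unitP; move: h_unit; rewrite def_h unitmx_mul => /andP[].
apply/matrixP => i j; pose k := (w^-1)%g j.
have wk : w k = j by rewrite /k permKV.
apply: (mulIf (t_neq0 k)).
have := congr1 (fun z : 'M_n => z i k) xh.
have xgw : x *m col_perm w g = col_perm w (x *m g) by rewrite !col_permE mulmxA.
rewrite def_h mulmxA xgw !mul_mx_diag !mxE wk => ->.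
by rewrite mulrAC.
Qed.

(** The matrix x = g^-1 h carries the regular element to a diagonal matrix, so
    each row of x has a single nonzero entry and x is monomial. *)
Lemma torus_of_eq g h : g \in unitmx -> h \in unitmx ->
  torus_of h = torus_of g ->
  exists (w : 'S_n) (t : 'rV[K]_n), h = col_perm w g *m diag_mx t.
Proof.
move=> g_unit h_unit eq_gh; have [x def_x] : exists x, x = invmx g *m h by eexists.
have x_unit : x \in unitmx by rewrite def_x unitmx_mul unitmx_inv g_unit.
have [u xE] : exists u, x *m diag_mx e = diag_mx u *m x.
  have : torus_of g (h *m diag_mx e *m invmx h).
    by rewrite -eq_gh; exists (diag_mx e) => //; exact: diagonal_group_regular.
  move=> /torus_of_eigenbasis[] // _ [u hg]; exists u.
  apply: (can_inj (mulKmx g_unit)); rewrite def_x !mulmxA mulmxV // mul1mx.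
  by rewrite -hg mulmxK // mulmxKV.
(* By x diag(e) = diag(u) x, a nonzero entry x i j forces e j = u i. *)
have row_once i j j' : x i j != 0 -> x i j' != 0 -> j = j'.
  move=> xij xij'; apply: e_inj.
  have xeq k : x i k * e 0 k = u 0 i * x i k.
    have := congr1 (fun z : 'M_n => z i k) xE.
    by rewrite mul_mx_diag mul_diag_mx !mxE.
  apply: (mulfI xij); rewrite xeq mulrC; congr (_ * _).
  by apply: (mulIf xij'); rewrite -xeq mulrC.
have col_nonzero j : exists i, x i j != 0.
  apply: contrapT => no_i; move: x_unit; rewrite unitmxE (expand_det_col _ j).
  rewrite big1 ?unitr0 // => i _.
  have [->|xij] := eqVneq (x i j) 0; first by rewrite mul0r.
  by case: no_i; exists i.
pose p j := xchoose (col_nonzero j).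
have pP j : x (p j) j != 0 by exact: (xchooseP (col_nonzero j)).
have p_inj : injective p.
  by move=> j j' pj; apply: (row_once (p j)); rewrite // pj.
exists (perm p_inj), (\row_j x (p j) j).
rewrite -[LHS](mulKVmx g_unit) -def_x; apply/matrixP => k j.
rewrite mul_mx_diag !mxE (bigD1 (p j)) //= permE big1 ?addr0 // => i ip.
have [->|xij] := eqVneq (x i j) 0; first by rewrite mulr0.
have [j' pj'] : exists j', p j' = i.
  by exists (invF p_inj i); rewrite f_invF.
case/eqP: ip; rewrite -pj'; congr p; apply: (row_once i) => //.
by rewrite -pj'.
Qed.

End Regular.

End DiagonalTori.

(** * Frobenius-stable maximal tori and their eigenlines *)

Lemma vlineZ (K : fieldType) (vT : vectType K) k (v : vT) :
  k != 0 -> <[k *: v]>%VS = <[v]>%VS.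
Proof.
move=> k_neq0; apply/eqP; rewrite eqEsubv -!memvE memvZ ?memv_line //.
by rewrite -{1}[v](scalerK k_neq0) memvZ ?memv_line.
Qed.

Section StableTori.
Variables (F : finFieldType) (K : closedFieldType) (iota : {rmorphism F -> K}).
Variables (phi : {rmorphism K -> K}) (phiE : forall x, phi x = x ^+ #|F|).
Hypothesis algK : forall x : K, algebraicOver iota x.

Lemma frob_surj y : exists x, phi x = y.
Proof.
have [[//|k] _ per_y] := algebraic_periodic phiE (algK y).
by exists (iter k phi y).
Qed.

Lemma common_period (I : finType) (u : I -> K) :
  exists2 k, (0 < k)%N & forall i, iter k phi (u i) = u i.
Proof.
have period i : exists k, (0 < k)%N && (iter k phi (u i) == u i).
  have [k k_gt0 per_k] := algebraic_periodic phiE (algK (u i)).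
  by exists k; rewrite k_gt0 per_k eqxx.
pose k i := ex_minn (period i).
have kP i : (0 < k i)%N /\ iter (k i) phi (u i) = u i.
  by rewrite /k; case: ex_minnP => m /andP[-> /eqP ->].
exists (\prod_i k i)%N; first by rewrite prodn_gt0 // => i; case: (kP i).
move=> i; rewrite (bigD1 i) //= mulnC iterM.
by elim: (\prod_(_ | _) _)%N => //= m ->; case: (kP i).
Qed.

(** The isomorphism with a diagonal group shows that x^(q^k) = x for some k > 0,
    and X^(q^k) - X has simple roots. *)
Lemma torus_diagonalizable n (T : set 'M[K]_n.+1) x :
  is_torus T -> T x -> diagonalizable x.
Proof.
move=> [_ [r [f [f' [[fT fM _] [f'T _ _] _ ff']]]]] Tx.
have Dd : diagonal_group K r (f' x) by exact: f'T.
have [u def_u] : exists u, f' x = diag_mx u by case: Dd => _ /diag_mxP.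
have [k k_gt0 per_u] := common_period (u 0).
have [s s_uniq def_s] := frob_poly_split iota k_gt0.
apply/diagonalizableP; exists s => //; rewrite -def_s.
apply: mxminpoly_min; rewrite rmorphB /= rmorphXn /= horner_mx_X.
(* The matrix f' x has size r, which may be 0: its powers are products
   of at least one factor, and [power m] stands for the exponent m + 1. *)
pose power m := iter m (mulmx (f' x)) (f' x).
have powerE m : power m = diag_mx (\row_i u 0 i ^+ m.+1).
  elim: m => [|m IHm] /=.
    by rewrite def_u; congr diag_mx; apply/matrixP => i j; rewrite ord1 !mxE.
  rewrite IHm def_u mulmx_diag; congr diag_mx; apply/matrixP => i j.
  by rewrite ord1 !mxE [in RHS]exprS.
have D_power m : diagonal_group K r (power m).
  by elim: m => [|m IHm] //=; exact: diagonal_groupM.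
have f_power m : f (power m) = x ^+ m.+1.
  elim: m => [|m IHm] /=; first by rewrite ff'.
  by rewrite fM ?ff' ?IHm // -exprS.
have Q_gt0 := ltnW (expq_gt1 F k_gt0).
rewrite -(prednK Q_gt0) -f_power powerE prednK // -[X in _ - X](ff' x Tx) def_u.
apply/eqP; rewrite subr_eq0; apply/eqP; congr (f (diag_mx _)).
by apply/matrixP => i j; rewrite ord1 !mxE -(iter_frobE phiE) per_u.
Qed.

Variable n : nat.
Hypothesis n_gt0 : (0 < n)%N.

Lemma torus_sub_torus_of (T : set 'M[K]_n) :
  is_torus T -> exists2 g, g \in unitmx & T `<=` torus_of g.
Proof.
case: n n_gt0 T => // m _ T T_torus; apply: simultaneous_diagonalization.
- by case: T_torus => -[[+ _ _ _] _ _]; exact.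
- by move=> x y; exact: torus_commutative.
- by move=> x; exact: torus_diagonalizable.
Qed.

(** The field of q^n elements has at least n nonzero ones. *)
Lemma exists_regular :
  exists2 e : 'rV[K]_n, injective (e 0) & forall i, e 0 i != 0.
Proof.
have [s [s_uniq s_size _]] := frob_fixed_seq iota phiE n_gt0.
pose s' := [seq x <- s | x != 0].
have s'_uniq : uniq s' by rewrite filter_uniq.
have s'_size : (n <= size s')%N.
  have := count_predC (pred1 0) s; rewrite size_filter (count_uniq_mem _ s_uniq).
  have n_lt : (n < #|F| ^ n)%N by rewrite ltn_expl // finNzRing_gt1.
  rewrite s_size => sz; move: n_lt; rewrite -sz.
  by case: (0 \in s) => /=; rewrite ?add0n ?add1n ?ltnS //; exact: ltnW.
have lt_i (i : 'I_n) : (i < size s')%N by exact: leq_trans (ltn_ord i) s'_size.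
exists (\row_i s'`_i) => [i j|i].
  by rewrite !mxE => /eqP; rewrite nth_uniq // => /eqP/ord_inj.
have := mem_nth 0 (lt_i i); rewrite mxE mem_filter => /andP[] //.
Qed.

Lemma maximal_torusP (T : set 'M[K]_n) :
  is_maximal_torus T <-> exists2 g, g \in unitmx & T = torus_of g.
Proof.
have [e e_inj e_neq0] := exists_regular.
split=> [[T_torus T_max]|[g g_unit ->]]; last exact: (torus_of_maximal e_inj).
have [g g_unit gT] := torus_sub_torus_of T_torus; exists g => //.
by rewrite (T_max (torus_of g)) //; exact: torus_of_is_torus.
Qed.

Lemma frobenius_mxE (A : 'M[K]_n) : frobenius_mx #|F| A = map_mx phi A.
Proof. by apply/matrixP => i j; rewrite !mxE phiE. Qed.

Lemma frobenius_torus_of (g : 'M[K]_n) :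
  frobenius_mx #|F| @` torus_of g = torus_of (map_mx phi g).
Proof.
have diag_frob (d : 'M[K]_n) : diagonal_group K n d ->
    diagonal_group K n (map_mx phi d).
  case=> d_unit /diag_mxP[u def_u]; split; first by rewrite map_unitmx.
  by rewrite def_u map_diag_mx diag_mx_is_diag.
apply/seteqP; split=> [_ [_ [d Dd <-] <-]|_ [d Dd <-]].
  exists (map_mx phi d); first exact: diag_frob.
  by rewrite frobenius_mxE !map_mxM map_invmx.
have [d_unit /diag_mxP[u def_u]] := Dd.
pose v := \row_i xget 0 [set x | phi x = u 0 i].
have phi_v : map_mx phi (diag_mx v) = d.
  rewrite def_u map_diag_mx; congr diag_mx; apply/matrixP => i j.
  rewrite !mxE ord1; case: xgetP => [x _ //|no_x].
  by have [x phix] := frob_surj (u 0 j); case: (no_x x).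
exists (g *m diag_mx v *m invmx g); last first.
  by rewrite frobenius_mxE !map_mxM map_invmx phi_v.
exists (diag_mx v) => //; split; last exact: diag_mx_is_diag.
by rewrite -(map_unitmx phi) phi_v.
Qed.

(** Between normalized bases, a monomial change of basis is a permutation. *)
Lemma col_perm_lead (g h : 'M[K]_n) (w : 'S_n) t :
  h = col_perm w g *m diag_mx t ->
  (forall j, lead (col j g) = 1) -> (forall j, lead (col j h) = 1) ->
  h = col_perm w g.
Proof.
move=> def_h g1 h1; have t1 j : t 0 j = 1.
  rewrite -(h1 j) -[LHS]mulr1 -(g1 (w j)) -leadZ def_h col_mul_diag.
  by congr (lead (_ *: _)); apply/matrixP => i k; rewrite !mxE.
by apply/matrixP => i j; rewrite def_h mul_mx_diag !mxE t1 mulr1.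
Qed.

(** Rescaling the columns of g does not change the torus; once they are
    normalized, so are those of phi(g), and stability says that phi(g) and g
    define the same torus. *)
Lemma stable_maximal_toriP (T : set 'M[K]_n) :
  stable_maximal_tori K #|F| n T <->
  exists w g, normal_bases phi w g /\ torus_of g = T.
Proof.
have [e e_inj e_neq0] := exists_regular; split; last first.
  move=> [w [g [[[g_unit tw_g] _] <-]]].
  split; first exact: (torus_of_maximal e_inj).
  rewrite frobenius_torus_of; apply: (torus_of_monomial e_inj e_neq0 (w := w)
    (t := const_mx 1)) => //; first by rewrite map_unitmx.
  by rewrite diag_const_mx mulmx1.
move=> [/maximal_torusP[h h_unit ->]]; rewrite frobenius_torus_of => stab_h.
pose c : 'rV[K]_n := \row_j (lead (col j h))^-1.
have c_unit : diag_mx c \in unitmx.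
  by apply/diag_mx_unitP => j; rewrite mxE invr_eq0 lead_col_neq0.
pose g := h *m diag_mx c.
have g_unit : g \in unitmx by rewrite unitmx_mul h_unit.
have gh : torus_of g = torus_of h.
  by apply: (torus_of_monomial e_inj e_neq0 (w := 1%g) (t := c)); rewrite ?col_perm1.
have g1 j : lead (col j g) = 1.
  by rewrite col_mul_diag leadZ mxE mulVf // lead_col_neq0.
have phig1 j : lead (col j (map_mx phi g)) = 1.
  by rewrite -map_col lead_map g1 rmorph1.
have : torus_of (map_mx phi g) = torus_of g.
  by rewrite -frobenius_torus_of gh frobenius_torus_of.
move/(torus_of_eq e_inj e_neq0); rewrite map_unitmx.
move=> /(_ g_unit g_unit)[w [t phig]].
exists w, g; split=> //; split=> //; split=> //.
exact: (col_perm_lead phig).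
Qed.

Lemma unitmx_col_inj (g : 'M[K]_n) i j k :
  g \in unitmx -> col i g = k *: col j g -> i = j.
Proof.
move=> g_unit; rewrite !colE scalemxAr => /(can_inj (mulKmx g_unit)).
move=> /matrixP/(_ i 0); rewrite !mxE !eqxx /= => /esym.
by case: eqP => // _; rewrite mulr0 => /eqP; rewrite eq_sym oner_eq0.
Qed.

Lemma col_perm_inj (g : 'M[K]_n) (v w : 'S_n) :
  g \in unitmx -> col_perm v g = col_perm w g -> v = w.
Proof.
move=> g_unit /matrixP vw; apply/perm.permP => j.
apply: (unitmx_col_inj (k := 1) g_unit); rewrite scale1r.
by apply/matrixP => i l; have := vw i j; rewrite !mxE.
Qed.

(** A line fixed by the regular element is spanned by a column of g.  That
    column is normalized, so if the line has a rational generator then the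
    column is itself rational, i.e. w fixes its index. *)
Lemma num_eigenvectors_torus_of (w : 'S_n) (g : 'M[K]_n) :
  normal_bases phi w g ->
  num_eigenvectors iota (torus_of g) = #|[set j | w j == j]%SET|.
Proof.
move=> [[g_unit /twistedP tw_g] g1].
have [e e_inj e_neq0] := exists_regular.
have phi_col j : map_mx phi (col j g) = col (w j) g.
  by apply/matrixP => i k; rewrite !mxE tw_g.
rewrite -/(ncard _) (_ : #|_| = ncard [set j | w j == j]); last first.
  by rewrite ncard_finType cardsE.
rewrite -(@ncard_image _ _ _ (fun j => <[col j g]>%VS)); first last.
- move=> i j _ _ eq_ij; have : col i g \in <[col j g]>%VS.
    by rewrite -eq_ij memv_line.
  by case/vlineP => k; exact: unitmx_col_inj.
- exact: finite_finset.
congr ncard; apply/seteqP; split=> [L [[dimL [v def_L]] fixL]|_ [j /eqP wj <-]].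
  pose v' := map_mx iota v.
  have v'_neq0 : v' != 0.
    by apply: contra_eq_neq dimL => v'0; rewrite def_L -/v' v'0 dim_vline eqxx.
  pose u := invmx g *m v'.
  have def_v' : v' = g *m u by rewrite mulKVmx.
  have [k xv] : exists k, (g *m diag_mx e *m invmx g) *m v' = k *: v'.
    apply/vlineP; rewrite -def_L -(fixL (g *m diag_mx e *m invmx g)).
      by rewrite def_L limg_line lfunE /= memv_line.
    exists (diag_mx e) => //; exact: (diagonal_group_regular e_neq0).
  have eu i : e 0 i * u i 0 = k * u i 0.
    have : diag_mx e *m u = k *: u.
      apply: (can_inj (mulKmx g_unit)); rewrite -scalemxAr -def_v' -xv.
      by rewrite /u !mulmxA.
    by move/matrixP/(_ i 0); rewrite mul_diag_mx [RHS]mxE mxE.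
  have [j uj] : exists j, u j 0 != 0.
    apply: contrapT => no_j; case/eqP: v'_neq0; rewrite def_v'.
    suff -> : u = 0 by rewrite mulmx0.
    apply/matrixP => i l; rewrite ord1 [RHS]mxE.
    by apply/eqP; apply: contrapT => /negP ui; apply: no_j; exists i.
  have def_u : u = u j 0 *: delta_mx j 0.
    apply/matrixP => i l; rewrite !ord1 [RHS]mxE [X in _ * X]mxE eqxx andbT.
    have [->|ij] := eqVneq i j; first by rewrite mulr1.
    rewrite mulr0; apply/eqP; apply: contraNT ij => ui; apply/eqP/e_inj.
    by rewrite (mulIf ui (eu i)) (mulIf uj (eu j)).
  have v'_col : v' = u j 0 *: col j g.
    by rewrite def_v' {1}def_u -scalemxAr colE.
  have phi_v' : map_mx phi v' = v'.
    by apply/matrixP => i l; rewrite !mxE (frob_iota iota phiE).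
  have lead_v' : lead v' = u j 0 by rewrite v'_col leadZ g1 mulr1.
  have phi_uj : phi (u j 0) = u j 0 by rewrite -lead_v' -lead_map phi_v'.
  have wj : w j = j.
    apply: (unitmx_col_inj (k := 1) g_unit); rewrite scale1r -phi_col.
    apply: (scalerI uj); rewrite -v'_col -[RHS]phi_v' v'_col -{1}phi_uj.
    by apply/matrixP => i l; rewrite !mxE rmorphM.
  by exists j; [exact: (introT eqP wj) | rewrite def_L -/v' v'_col vlineZ].
have gj_neq0 : col j g != 0 by rewrite -lead_eq0 g1 oner_eq0.
split; last first.
  move=> x /torus_of_eigenbasis[] // x_unit [u xg].
  have xgj : x *m col j g = u 0 j *: col j g.
    rewrite !colE mulmxA xg; apply/matrixP => i l.
    by rewrite -!colE mxE mul_mx_diag !mxE mulrC.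
  rewrite limg_line lfunE /= xgj vlineZ //.
  apply: contraNneq gj_neq0 => uj; rewrite uj scale0r in xgj.
  by rewrite -[col j g](mulKmx x_unit) xgj mulmx0.
split; first by rewrite dim_vline gj_neq0.
have rational i : exists a, col j g i 0 = iota a.
  by apply: (frob_fixedP iota phiE _).1; rewrite mxE tw_g wj.
exists (\col_i xget 0 [set a | col j g i 0 = iota a]).
congr (<[_]>%VS); apply/matrixP => i k; rewrite ord1 [RHS]mxE [X in iota X]mxE.
case: xgetP => [a _ //|no_a].
by have [a gij] := rational i; case: (no_a a).
Qed.

(** Pairs (w, g), although g determines w, so that sums over them can be sorted
    by w. *)
Definition framed_tori : set ('S_n * 'M[K]_n) :=
  [set wg | normal_bases phi wg.1 wg.2].

Lemma finite_framed_tori : finite_set framed_tori.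
Proof.
pose M := \bigcup_(w in [set: 'S_n]) normal_bases phi w.
apply: (@sub_finite_set _ _ ([set: 'S_n] `*` M)).
  by move=> [w g] nb; split=> //; exists w.
apply: finite_setX; first exact: finite_finset.
apply: bigcup_finite => [|w _]; first exact: finite_finset.
exact: (finite_normal_bases iota phiE).
Qed.

Lemma sum_framed_tori (V : nmodType) (H : 'S_n -> V) :
  \sum_(wg <- fset_set framed_tori) H wg.1
    = \sum_w H w *+ ncard (normal_bases phi w).
Proof.
rewrite (partition_big fst xpredT) //=; apply: eq_bigr => w _.
rewrite (eq_bigr (fun=> H w)) => [|wg /eqP -> //].
rewrite (_ : ncard _ = ncard [set wg | framed_tori wg /\ wg.1 == w]).
  rewrite ncard_sub; last exact: finite_framed_tori.
  by rewrite -(sumrMnr (H w) _ _ (fun=> 1%N)).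
apply: (@ncard_bij _ _ _ _ (pair w) snd).
- exact: (finite_normal_bases iota phiE).
- by move=> g nb; split=> //; split=> /=.
- by move=> [v g] [nb /eqP /= <-].
Qed.

(** The normalized bases of a stable torus are the n! reorderings of the columns
    of any one of them; reordering by v conjugates w by v. *)
Lemma ncard_frames_of_torus (T : set 'M[K]_n) : stable_maximal_tori K #|F| n T ->
  ncard [set wg | framed_tori wg /\ torus_of wg.2 == T] = n`!.
Proof.
have [e e_inj e_neq0] := exists_regular.
move=> /stable_maximal_toriP[w [g [[[g_unit tw_g] g1] <-]]].
pose f (v : 'S_n) := ((v * w * v^-1)%g, col_perm v g).
rewrite -card_Sn -ncard_setT -(@ncard_image _ _ _ f); first last.
- by move=> v v' _ _ [_]; exact: col_perm_inj.
- exact: finite_finset.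
have unit_perm v : col_perm v g \in unitmx.
  by rewrite col_permE unitmx_mul g_unit unitmx_perm.
have lead_perm v j : lead (col j (col_perm v g)) = 1.
  by rewrite -[RHS](g1 (v j)); congr lead; apply/matrixP => i k; rewrite !mxE.
have tw_perm v : twisted phi (v * w * v^-1)%g (col_perm v g).
  by apply/twistedP => i j; rewrite !mxE !permM permKV; move/twistedP: tw_g => ->.
congr ncard; apply/seteqP; split=> [[v h]|_ [v _ <-]] /=; last first.
  split.
    by split; [split; [exact: unit_perm | exact: tw_perm] | exact: lead_perm].
  apply/eqP/(torus_of_monomial e_inj e_neq0 (w := v) (t := const_mx 1)) => //.
  by rewrite diag_const_mx mulmx1.
move=> [[[h_unit tw_h] h1] /eqP /(torus_of_eq e_inj e_neq0 g_unit h_unit)].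
move=> [s [t /col_perm_lead def_h]].
have {}def_h : h = col_perm s g by exact: def_h.
exists s => //; congr pair => //; apply: (col_perm_inj h_unit).
rewrite -[RHS]tw_h def_h; exact/esym/tw_perm.
Qed.

End StableTori.

Lemma mean_eq_geometric_sum (q n b f X Y : nat) (S : rat) :
  (1 < q)%N -> (0 < n)%N -> (0 < X)%N ->
  (b * f = X)%N -> S * f%:R = Y%:R ->
  ((q ^ n - 1) * X = (q - 1) * q ^ n.-1 * Y)%N ->
  S / b%:R = \sum_(i < n) (q%:R ^+ i)^-1.
Proof.
move=> q_gt1 n_gt0 X_gt0 bf Sf ratio.
have q_gt0 := ltnW q_gt1.
have q_neq0 : q%:R != 0 :> rat by rewrite pnatr_eq0 -lt0n.
have geometric : (q%:R - 1) * q%:R ^+ n.-1 * \sum_(i < n) (q%:R ^+ i)^-1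
    = q%:R ^+ n - 1 :> rat.
  rewrite subrX1 -mulrA; congr (_ * _).
  rewrite mulr_sumr (reindex_inj rev_ord_inj) /=; apply: eq_bigr => i _.
  have le_in : (n - i.+1 <= n.-1)%N by rewrite -subn1 leq_sub2l.
  rewrite -{1}(subnK le_in) exprD mulfK ?expf_neq0 //; congr (_ ^+ _).
  by rewrite subnS predn_sub subKn // -ltnS prednK.
have [b_gt0 f_gt0] : (0 < b)%N /\ (0 < f)%N.
  by apply/andP; rewrite -muln_gt0 bf.
have b_neq0 : b%:R != 0 :> rat by rewrite pnatr_eq0 -lt0n.
have f_neq0 : f%:R != 0 :> rat by rewrite pnatr_eq0 -lt0n.
have c_neq0 : (q%:R - 1) * q%:R ^+ n.-1 != 0 :> rat.
  by rewrite mulf_neq0 ?expf_neq0 // subr_eq0 pnatr_eq1 gtn_eqF.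
apply: (canLR (mulfK b_neq0)); apply: (mulIf f_neq0).
rewrite Sf -mulrA -natrM bf; apply: (mulfI c_neq0); rewrite mulrA geometric.
have := congr1 (fun m => m%:R : rat) ratio.
by rewrite !natrM natrB ?expn_gt0 ?q_gt0 // natrB // !natrX => ->.
Qed.

Theorem theorem3p5 (q : nat) (F : finFieldType) (cardF : #|F| = q)
    (K : closedFieldType) (iota : {rmorphism F -> K})
    (algK : forall x : K, algebraicOver iota x)
    (n : nat) (n_gt0 : (0 < n)%N) :
  finite_set (stable_maximal_tori K q n) /\
  uniform_expectation (stable_maximal_tori K q n)
    (fun T => (num_eigenvectors iota T)%:R) =
  \sum_(i < n) (q%:R ^+ i)^-1.
Proof.
subst q; have [phi phiE] := frobenius_rmorphism iota.
set B := stable_maximal_tori K _ n; set q := #|F|.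
have finA := finite_framed_tori iota phiE n.
have toriE : (fun wg => torus_of wg.2) @` @framed_tori K phi n = B.
  apply/seteqP; split=> [_ [[w g] nb <-]|T].
    by apply/(stable_maximal_toriP phiE algK n_gt0); exists w, g.
  case/(stable_maximal_toriP phiE algK n_gt0) => w [g [nb gT]].
  by exists (w, g).
split; first by rewrite -toriE; exact: finite_image.
pose N w := ncard (normal_bases phi (w : 'S_n)).
pose fixed (w : 'S_n) := #|[set j | w j == j]%SET|.
have fibers := ncard_frames_of_torus phiE algK n_gt0.
have count_tori : (ncard B * n`! = \sum_w N w)%N.
  rewrite -(ncard_const_fibers finA toriE fibers).
  rewrite -[LHS](sum1_size (fset_set (@framed_tori K phi n))).
  apply: etrans (sum_framed_tori iota phiE (fun=> 1%N)) _.
  by apply: eq_bigr => w _; rewrite -mulr_natr natn mul1r.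
have count_eigen :
    (\sum_(T <- fset_set B) (num_eigenvectors iota T)%:R) * n`!%:R
    = (\sum_w N w * fixed w)%:R :> rat.
  rewrite mulr_natr.
  rewrite -(sum_over_fibers _ finA toriE fibers).
  rewrite (eq_big_seq (fun wg => (fixed wg.1)%:R)).
    rewrite (sum_framed_tori iota phiE (fun w => (fixed w)%:R)) natr_sum.
    by apply: eq_bigr => w _; rewrite natrM mulr_natl.
  move=> [w g]; rewrite in_fset_set // inE => nb; congr _%:R.
  exact: (num_eigenvectors_torus_of iota phiE n_gt0 nb).
have q_gt1 : (1 < q)%N by exact: finNzRing_gt1.
have X_gt0 : (0 < \sum_w N w)%N.
  rewrite (bigD1 1%g) //= addn_gt0 /N; apply/orP; left.
  have := ncard_GL_gt0 F n.
  by rewrite -(ncard_normal_bases iota phiE 1%g) muln_gt0 => /andP[].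
exact: (mean_eq_geometric_sum q_gt1 n_gt0 X_gt0 count_tori count_eigen
          (sum_normal_bases iota phiE n)).
Qed.
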